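(* Let $V$ be a finitely generated $\mathrm{VI}$-module over a field $\Bbbk$ of characteristic zero. Then there exist a polynomial $P\in\mathbb{Q}[T]$ and an integer $N$ such that $\dim_\Bbbk(V_n)=P(q^n)$ for all $n\ge N$.
   Context: Fix a finite field $\mathbb{F}_q$ with $q$ elements. $\mathrm{VI}$ is the category whose objects are finite dimensional $\mathbb{F}_q$-vector spaces and whose morphisms are injective linear maps. A $\mathrm{VI}$-module over a field $\Bbbk$ is a functor from $\mathrm{VI}$ to $\Bbbk$-vector spaces; submodules are subfunctors. Write $V_n=V(\mathbb{F}_q^n)$. $V$ is finitely generated if there is a finite subset $S\subseteq\bigsqcup_n V_n$ such that the only submodule of $V$ containing $S$ is $V$. *)

(* Defs.v *)
From HB Require Import structures.
From mathcomp Require Import all_boot all_order all_algebra all_field.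
Set Implicit Arguments. Unset Strict Implicit. Unset Printing Implicit Defensive.
Import GRing.Theory.
Local Open Scope ring_scope.

(* VI over the finite field F (q = #|F|), skeletal version: the objects are
   F^n (row vectors 'rV[F]_n), and an injective linear map F^m -> F^n is
   v |-> v *m A for a matrix A : 'M[F]_(m,n) with row_free A.
   Composition "first A then B" is the matrix A *m B. *)

Record VImodule (F : finFieldType) (k : fieldType) := VIModule {
  vi_obj :> nat -> lmodType k;
  vi_act : forall m n : nat, 'M[F]_(m, n) -> vi_obj m -> vi_obj n;
  vi_act_lin : forall m n (A : 'M[F]_(m, n)), row_free A ->
    forall (a : k) (x y : vi_obj m),
      vi_act A (a *: x + y) = a *: vi_act A x + vi_act A y;
  vi_act_id : forall n (x : vi_obj n), vi_act (1%:M : 'M[F]_n) x = x;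
  vi_act_comp : forall m n p (A : 'M[F]_(m, n)) (B : 'M[F]_(n, p)),
    row_free A -> row_free B ->
    forall x : vi_obj m, vi_act (A *m B) x = vi_act B (vi_act A x)
}.

Definition is_submodule (F : finFieldType) (k : fieldType) (V : VImodule F k)
  (W : forall n, V n -> Prop) : Prop :=
  (forall n, W n 0) /\
  (forall n (x y : V n), W n x -> W n y -> W n (x + y)) /\
  (forall n (a : k) (x : V n), W n x -> W n (a *: x)) /\
  (forall m n (A : 'M[F]_(m, n)) (x : V m), row_free A -> W m x ->
      W n (@vi_act F k V m n A x)).

Definition VI_fin_gen (F : finFieldType) (k : fieldType) (V : VImodule F k) : Prop :=
  exists (r : nat) (deg : 'I_r -> nat) (gen : forall i : 'I_r, V (deg i)),
    forall W : forall n, V n -> Prop, is_submodule W ->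
      (forall i, W (deg i) (gen i)) -> forall n (x : V n), W n x.

Definition has_dim (k : fieldType) (M : lmodType k) (d : nat) : Prop :=
  exists b : 'I_d -> M,
    (forall c : 'I_d -> k, \sum_(i < d) c i *: b i = 0 -> forall i, c i = 0) /\
    (forall v : M, exists c : 'I_d -> k, v = \sum_(i < d) c i *: b i).

(* Main.v *)
(* A finitely generated VI-module V is a quotient of a free module with basis
   I x 'M_(d, n) in degree n, so it suffices to treat a submodule K of it, by
   induction on d.  Let LK_n be the union over c of the images of K_(n + c) in the
   coinvariants of the free module under the pointwise stabilizer of F^n in
   GL_(n + c); the orbits of matrices are the partial linear maps from F^d to F^n.
   - The restrictions of partial maps to subspaces Y of F^n act on LK_n as
     idempotents e_Y with e_Y e_Z = e_(Y :&: Z) and dim (e_Y LK_n) = dim LK_(dim Y).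
     For n > d the product of the 1 - e_Y over proper subspaces Y vanishes on LK_n,
     and the resulting inclusion-exclusion recursion forces dim LK_n = P(q^n).
   - For n large, K_n is the part of LK_n supported on total maps.  This is where
     characteristic zero enters: every constituent of k[I x 'M_(d, n)] has nonzero
     invariants under the stabilizer of F^d, and these are controlled by LK_d.
   - The projection of LK_n to the partial maps with proper domain is a submodule
     of a free module of the same kind for d - 1, to which induction applies. *)
Require Import Defs.
From Stdlib Require Import Classical ClassicalEpsilon.
From HB Require Import structures.
From mathcomp Require Import all_boot all_order all_algebra all_field.
Set Implicit Arguments. Unset Strict Implicit. Unset Printing Implicit Defensive.
Import Order.TTheory GRing.Theory Num.Theory.
Local Open Scope ring_scope.

(** * Subspaces and stable chains *)

Section Classical.

Lemma exists_argmax (T : Type) (P : T -> Prop) (f : T -> nat) (m : nat) :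
  (exists x, P x) -> (forall x, P x -> f x <= m)%N ->
  exists2 x, P x & forall y, P y -> (f y <= f x)%N.
Proof.
move=> [x0 Px0] fle.
have [e] := ubnP (m - f x0)%N; elim: e x0 Px0 => // e IHe x Px lte.
have [[y [Py ltxy]]|noy] := classic (exists y, P y /\ (f x < f y)%N).
  apply: (IHe y Py); rewrite -ltnS (leq_trans _ lte)// ltnS ltn_sub2l//.
  exact: leq_trans ltxy (fle _ Py).
exists x => // y Py; rewrite leqNgt; apply/negP => ltxy.
by apply: noy; exists y.
Qed.

Variables (k : fieldType) (vT : vectType k).

(** A [{vspace vT}] of maximal dimension inside [W] absorbs the line through each element of [W], so
    it is all of [W]. *)
Lemma vspace_of_subspace (W : vT -> Prop) :
  W 0 -> (forall a x y, W x -> W y -> W (a *: x + y)) ->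
  exists U : {vspace vT}, forall x, (x \in U) <-> W x.
Proof.
move=> W0 Wlin.
have [||U UW Umax] := @exists_argmax {vspace vT}
  (fun U => forall x, x \in U -> W x) (fun U => \dim U) (dim vT).
- by exists 0%VS => x; rewrite memv0 => /eqP->.
- by move=> U _; rewrite -dimvf dimvS// subvf.
exists U => x; split=> [|Wx]; first exact: UW.
have sub : (U <= U + <[x]>)%VS by exact: addvSl.
have := Umax (U + <[x]>)%VS.
have H y : y \in (U + <[x]>)%VS -> W y.
  case/memv_addP=> u uU [v /vlineP[a ->] ->].
  by rewrite addrC; apply: Wlin => //; exact: UW.
move=> /(_ H) le; have /eqP-> : U == (U + <[x]>)%VS by rewrite eqEdim sub.
by apply: (subvP (addvSr _ _)); exact: memv_line.
Qed.

Lemma vspace_chain_stable (U : nat -> {vspace vT}) :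
  (forall m n, (m <= n)%N -> (U m <= U n)%VS) ->
  exists N, forall n, (N <= n)%N -> U n = U N.
Proof.
move=> Umono.
have [||N _ Nmax] := @exists_argmax nat (fun=> True) (fun n => \dim (U n)) (dim vT).
- by exists 0%N.
- by move=> n _; rewrite -dimvf dimvS// subvf.
by exists N => n leNn; apply/esym/eqP; rewrite eqEdim Umono//= Nmax.
Qed.

Lemma dim_idempotent_split (E : 'End(vT)) (U : {vspace vT}) :
  (E \o E = E)%VF -> (E @: U <= U)%VS ->
  \dim U = (\dim (E @: U) + \dim ((\1 - E)%VF @: U))%N.
Proof.
move=> EE EU; rewrite -(limg_ker_dim E U) addnC; congr (_ + \dim _)%N.
apply/eqP; rewrite eqEsubv; apply/andP; split; apply/subvP=> x.
  rewrite memv_cap memv_ker => /andP[xU /eqP Ex].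
  by apply/memv_imgP; exists x; rewrite // add_lfunE opp_lfunE id_lfunE Ex subr0.
case/memv_imgP=> u uU ->; rewrite add_lfunE opp_lfunE id_lfunE memv_cap memv_ker.
rewrite linearB /= -[E (E u)]comp_lfunE EE subrr eqxx andbT.
by rewrite memvB// (subvP EU)// memv_img.
Qed.

Lemma dim_img_cancel (wT : vectType k) (f : 'Hom(vT, wT)) (g : 'Hom(wT, vT)) 
  (U : {vspace vT}) : (forall x, x \in U -> g (f x) = x) -> \dim (f @: U) = \dim U.
Proof.
move=> fK; rewrite -(limg_ker_dim f U).
suff -> : (U :&: lker f = 0)%VS by rewrite dimv0.
apply/eqP; rewrite -subv0; apply/subvP=> x; rewrite memv_cap memv_ker memv0.
by case/andP=> xU /eqP fx; rewrite -(fK x xU) fx linear0.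
Qed.

End Classical.

(** * Free modules and maps induced by partial functions of bases *)

Section Push.
Variable k : fieldType.

Definition dlt (A : finType) (a : A) : {ffun A -> k^o} := [ffun a' => (a' == a)%:R].

Lemma ffun_sum_dlt (A : finType) (x : {ffun A -> k^o}) :
  x = \sum_a x a *: dlt a.
Proof.
apply/ffunP=> a; rewrite sum_ffunE (bigD1 a)//= !ffunE eqxx.
rewrite big1 ?addr0 ?[_ *: _]mulr1// => b /negPf ba.
by rewrite !ffunE eq_sym ba [_ *: _]mulr0.
Qed.

Lemma lfun_dltP (A : finType) (vT : vectType k) (f g : 'Hom({ffun A -> k^o}, vT)) :
  (forall a, f (dlt a) = g (dlt a)) -> f = g.
Proof.
move=> fg; apply/lfunP=> x; rewrite (ffun_sum_dlt x) !linear_sum.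
by apply: eq_bigr => a _; rewrite !linearZ /= fg.
Qed.

(** The linear extension of a partial map of bases: basis vectors sent to [None] go to zero. *)
Definition push_fun (A B : finType) (f : A -> option B) (x : {ffun A -> k^o}) :
  {ffun B -> k^o} := [ffun b => \sum_(a | f a == Some b) x a].

Lemma push_fun_linear (A B : finType) (f : A -> option B) : linear (push_fun f).
Proof.
move=> c x y; apply/ffunP=> b; rewrite !ffunE scaler_sumr -big_split /=.
by apply: eq_bigr => a _; rewrite !ffunE.
Qed.

HB.instance Definition _ (A B : finType) (f : A -> option B) :=
  GRing.isLinear.Build _ _ _ _ (push_fun f) (push_fun_linear f).

Definition push (A B : finType) (f : A -> option B) := linfun (push_fun f).
Definition pusht (A B : finType) (f : A -> B) := push (fun a => Some (f a)).

Lemma pushE (A B : finType) (f : A -> option B) x b :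
  push f x b = \sum_(a | f a == Some b) x a.
Proof. by rewrite lfunE ffunE. Qed.

Lemma push_dlt (A B : finType) (f : A -> option B) a :
  push f (dlt a) = if f a is Some b then dlt b else 0.
Proof.
have E b : push f (dlt a) b = (f a == Some b)%:R.
  rewrite pushE; case: eqP => [fab|/eqP nfab].
    rewrite (bigD1 a) ?fab//= ffunE eqxx big1 ?addr0// => i /andP[_ /negPf ia].
    by rewrite ffunE ia.
  rewrite big1// => i fib; rewrite ffunE; case: eqVneq => // ia.
  by rewrite -ia fib in nfab.
apply/ffunP=> b; rewrite E; case: (f a) => [b'|]; rewrite !ffunE//.
by rewrite (inj_eq Some_inj) eq_sym.
Qed.

#[global] Opaque push.

Lemma pusht_dlt (A B : finType) (f : A -> B) a : pusht f (dlt a) = dlt (f a).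
Proof. exact: push_dlt. Qed.

Lemma push_pusht (A B C : finType) (g : B -> option C) (f : A -> B) x :
  push g (pusht f x) = push (g \o f) x.
Proof.
rewrite -comp_lfunE; congr (fun_of_lfun _ x); apply: lfun_dltP => a.
by rewrite comp_lfunE pusht_dlt !push_dlt.
Qed.

Lemma pusht_comp (A B C : finType) (g : B -> C) (f : A -> B) x :
  pusht g (pusht f x) = pusht (g \o f) x.
Proof. exact: push_pusht. Qed.

Lemma eq_pusht (A B : finType) (g f : A -> B) : f =1 g -> pusht f = pusht g.
Proof. by move=> fg; apply: lfun_dltP => a; rewrite !pusht_dlt fg. Qed.

Lemma pusht_compE (A B C : finType) (g : B -> C) (f : A -> B) (h : A -> C) x :
  (forall a, g (f a) = h a) -> pusht g (pusht f x) = pusht h x.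
Proof. by move=> gfh; rewrite pusht_comp (eq_pusht (f := g \o f) gfh). Qed.

Lemma eq_push (A B : finType) (g f : A -> option B) : f =1 g -> push f = push g.
Proof. by move=> fg; apply: lfun_dltP => a; rewrite !push_dlt fg. Qed.

Lemma pusht_id (A : finType) (f : A -> A) x : f =1 id -> pusht f x = x.
Proof.
move=> fid; rewrite -[RHS]id_lfunE; congr (fun_of_lfun _ x).
by apply: lfun_dltP => a; rewrite pusht_dlt fid id_lfunE.
Qed.

Lemma pusht_inj (A B : finType) (f : A -> B) : injective f ->
  forall x a, pusht f x (f a) = x a.
Proof.
move=> finj x a; rewrite pushE (big_pred1 a)// => b.
by rewrite /= (inj_eq Some_inj) (inj_eq finj).
Qed.

End Push.

(** * Inclusion-exclusion over subspaces *)

Section Interpolation.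

Lemma poly_interpolation (R : fieldType) (x y : nat -> R) n : injective x ->
  exists2 P : {poly R}, (size P <= n)%N & forall i, (i < n)%N -> P.[x i] = y i.
Proof.
move=> xinj; elim: n => [|n [P sP Py]]; first by exists 0; rewrite ?size_poly0.
pose W := \prod_(i < n) ('X - (x i)%:P).
have Wn0 : W.[x n] != 0.
  rewrite horner_prod; apply/prodf_neq0 => i _.
  by rewrite hornerXsubC subr_eq0 (inj_eq xinj) neq_ltn ltn_ord orbT.
exists (P + ((y n - P.[x n]) / W.[x n])%:P * W) => [|i].
  rewrite (leq_trans (size_polyD _ _))// geq_max (leq_trans sP)//=.
  rewrite mul_polyC (leq_trans (size_scale_leq _ _))//.
  by rewrite size_prod_XsubC /index_enum -enumT size_enum_ord.
rewrite ltnS leq_eqVlt hornerD hornerCM => /orP[/eqP->|ltin].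
  by rewrite divfK// addrC subrK.
suff -> : W.[x i] = 0 by rewrite mulr0 addr0 Py.
apply/eqP; rewrite horner_prod prodf_seq_eq0; apply/hasP.
by exists (Ordinal ltin); rewrite ?mem_index_enum//= hornerXsubC subrr.
Qed.

End Interpolation.

Section AlternatingSum.
Variables (F : fieldType) (n : nat).
Implicit Types (Z : 'M[F]_n) (hs : seq 'M[F]_n).

(* The inclusion-exclusion sum of (-1)^|S| g(Z :&: \bigcap_(h in S) h) over the
   sublists S of hs. *)
Fixpoint alt (R : zmodType) (g : 'M[F]_n -> R) Z hs : R :=
  if hs is h :: hs' then alt g Z hs' - alt g (Z :&: h)%MS hs' else g Z.

Lemma eq_alt (R : zmodType) (g g' : 'M_n -> R) Z hs : g =1 g' -> alt g Z hs = alt g' Z hs.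
Proof. by move=> gg; elim: hs Z => //= h hs IHs Z; rewrite !IHs. Qed.

Lemma alt_sum (R : pzRingType) (J : finType) (c : J -> R) (g : J -> 'M_n -> R) Z hs :
  alt (fun Y => \sum_j c j * g j Y) Z hs = \sum_j c j * alt (g j) Z hs.
Proof.
elim: hs Z => //= h hs IHs Z; rewrite !IHs -sumrB.
by apply: eq_bigr => j _; rewrite mulrBr.
Qed.

Lemma altB (R : zmodType) (g g' : 'M_n -> R) Z hs :
  alt (fun Y => g Y - g' Y) Z hs = alt g Z hs - alt g' Z hs.
Proof.
elim: hs Z => //= h hs IHs Z; rewrite !IHs !opprB addrACA [RHS]addrAC -!addrA.
by congr (_ + _); rewrite addrC !addrA addrAC.
Qed.

(** Each nonempty sublist of [hs] contributes [g] at a rank below [n], hence zero; only the empty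
    one remains. *)
Lemma alt_low (R : zmodType) (g : nat -> R) Z hs :
  (forall r, (r < n)%N -> g r = 0) -> all (fun h => \rank h < n)%N hs ->
  alt (fun Y => g (\rank Y)) Z hs = g (\rank Z).
Proof.
move=> g0; elim: hs Z => //= h hs IHs Z /andP[ltn ltns]; rewrite !IHs//.
by rewrite (g0 (\rank (Z :&: h)%MS)) ?subr0// (leq_ltn_trans _ ltn)// mxrankS// capmxSr.
Qed.

End AlternatingSum.

Section AlternatingDimension.
Variables (k : fieldType) (vT : vectType k) (F : fieldType) (n : nat).
Variables (E : 'M[F]_n -> 'End(vT)) (W : {vspace vT}).
Hypothesis Ecap : forall Y Z x, E Z (E Y x) = E (Y :&: Z)%MS x.
Hypothesis Eid : forall Y x, E Y (E Y x) = E Y x.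
Hypothesis EW : forall Y x, x \in W -> E Y x \in W.

(** The [E h] commute, so this composite keeps what lies in the image of [E Z] and is killed by
    every [E h]. *)
Fixpoint cores (hs : seq 'M[F]_n) (Z : 'M[F]_n) : 'End(vT) :=
  if hs is h :: hs' then ((\1 - E h) \o cores hs' Z)%VF else E Z.

Lemma cores_cons h hs Z x : cores (h :: hs) Z x = cores hs Z x - E h (cores hs Z x).
Proof. by rewrite comp_lfunE add_lfunE opp_lfunE id_lfunE. Qed.

Lemma idem_cores h hs Z x : E h (cores hs Z x) = cores hs Z (E h x).
Proof.
elim: hs => [|h' hs IHs]; first by rewrite /= !Ecap capmxC.
by rewrite !cores_cons linearB /= -IHs; congr (_ - _); rewrite !Ecap capmxC.
Qed.

Lemma cores_cap h hs Z x : cores hs (Z :&: h)%MS x = E h (cores hs Z x).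
Proof.
elim: hs => [|h' hs IHs]; first by rewrite /= Ecap.
by rewrite !cores_cons !IHs linearB /=; congr (_ - _); rewrite !Ecap capmxC.
Qed.

Lemma cores_eq0 h hs Z x : h \in hs -> E h x = x -> cores hs Z x = 0.
Proof.
move=> hhs hx; elim: hs hhs => // h' hs IHs; rewrite inE cores_cons.
case/predU1P=> [<-|/IHs ->]; last by rewrite linear0 subrr.
by rewrite idem_cores hx subrr.
Qed.

(** [E h] splits the image of [cores hs Z] in two: the part it fixes is the image of
    [cores hs (Z :&: h)], the part it kills that of [cores (h :: hs) Z]. *)
Lemma alt_dim hs Z :
  alt (fun Y => (\dim (E Y @: W))%:R : rat) Z hs = (\dim (cores hs Z @: W))%:R.
Proof.
elim: hs Z => [|h hs IHs] Z //=.
rewrite !IHs; apply/eqP; rewrite subr_eq -natrD eqr_nat addnC.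
rewrite (@dim_idempotent_split _ _ (E h) (cores hs Z @: W)).
- rewrite -!limg_comp; apply/eqP; congr (\dim (_ @: _) + _)%N.
  by apply/lfunP=> x; rewrite comp_lfunE cores_cap.
- by apply/lfunP=> x; rewrite comp_lfunE Eid.
- apply/subvP=> _ /memv_imgP[_ /memv_imgP[x xW ->] ->].
  by rewrite idem_cores memv_img// EW.
Qed.

End AlternatingDimension.

Section CountSubspaceMatrices.
Variables (F : finFieldType) (n t : nat).

Lemma card_submx (Z : 'M[F]_n) :
  #|[set A : 'M[F]_(t, n) | (A <= Z)%MS]| = (#|F| ^ (t * \rank Z))%N.
Proof.
rewrite -card_mx -(card_imset (f := fun B : 'M[F]_(t, \rank Z) => B *m row_base Z)).
  apply: eq_card => A; rewrite inE; apply/idP/imsetP => [|[B _ ->]].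
    by rewrite -(eq_row_base Z) => /submxP[B ->]; exists B.
  by rewrite -(eq_row_base Z) submxMl.
exact: row_free_inj (row_base_free Z).
Qed.

(** Inclusion-exclusion, as each term counts the matrices with row space inside [Y]. *)
Lemma alt_card_submx (Z : 'M[F]_n) hs :
  alt (fun Y => (#|F| ^ (t * \rank Y))%:R : rat) Z hs =
  #|[set A : 'M[F]_(t, n) | (A <= Z)%MS & all (fun h => ~~ (A <= h)%MS) hs]|%:R.
Proof.
elim: hs Z => [|h hs IHs] Z /=.
  by rewrite -card_submx; congr (_%:R); apply: eq_card => A; rewrite !inE andbT.
rewrite !IHs; apply/eqP; rewrite subr_eq -natrD; apply/eqP; congr (_%:R).
rewrite -(cardsID [set A | (A <= h)%MS]) addnC; congr (_ + _)%N; apply: eq_card => A;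
  by rewrite !inE ?sub_capmx; case: (A <= Z)%MS; case: (A <= h)%MS; case: all.
Qed.

Lemma alt_exp_eq0 hs : (forall A : 'M[F]_(t, n), exists2 h, h \in hs & (A <= h)%MS) ->
  alt (fun Y => (#|F| ^ (t * \rank Y))%:R : rat) 1%:M hs = 0.
Proof.
move=> cov; rewrite alt_card_submx; apply/eqP; rewrite pnatr_eq0 cards_eq0 -subset0.
apply/subsetP=> A; rewrite !inE => /andP[_ /allP nA].
by have [h /nA /negP] := cov A.
Qed.

End CountSubspaceMatrices.

Section RecursionPolynomial.
Variables (F : finFieldType) (d : nat) (D : nat -> rat).

Definition small_mx n : seq 'M[F]_n := [seq Y <- enum 'M[F]_n | (\rank Y < n)%N].

Lemma mem_small_mx n (Y : 'M_n) : (\rank Y < n)%N -> Y \in small_mx n.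
Proof. by move=> rY; rewrite mem_filter rY mem_enum. Qed.

(* For t <= d the functions n |-> q^(t n) satisfy the same recursion, because
   every map from F^t to F^n has image in a proper subspace when t < n; as the
   recursion determines D from D 0, ..., D d, interpolation at q^0, ..., q^d
   suffices. *)
Lemma alt_recursion_polynomial :
  (forall n, (d < n)%N -> alt (fun Y => D (\rank Y)) 1%:M (small_mx n) = 0) ->
  exists P : {poly rat}, forall n, P.[(#|F| ^ n)%:R] = D n.
Proof.
move=> recD; have [|P sP PD] := @poly_interpolation rat (fun n => (#|F| ^ n)%:R) D d.+1.
  by move=> m n /eqP; rewrite eqr_nat => /eqP /(expnI (finRing_gt1 F)).
exists P => n; have [m] := ubnP n; elim: m n => // m IHm n; rewrite ltnS => lenm.
have [ltnd|ltdn] := ltnP n d.+1; first exact: PD.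
(* By induction [g] vanishes below [n], so its alternating sum is the single term [g n]; this sum is
   zero because [P] and [D] both obey the recursion. *)
pose g r := P.[(#|F| ^ r)%:R] - D r.
have glow : alt (fun Y => g (\rank Y)) 1%:M (small_mx n) = g n.
  rewrite -[in RHS](mxrank1 F n); apply: alt_low.
    by move=> r ltrn; rewrite /g IHm ?subrr// (leq_trans ltrn).
  by apply/allP=> Y; rewrite mem_filter; case/andP.
apply/eqP; rewrite -subr_eq0 -[X in X == 0]/(g n) -glow.
rewrite altB recD// subr0.
have -> : alt (fun Y : 'M[F]_n => P.[(#|F| ^ \rank Y)%:R]) 1%:M (small_mx n) =
  alt (fun Y => \sum_(t < d.+1) P`_t * (#|F| ^ (t * \rank Y))%:R) 1%:M (small_mx n).
  apply: eq_alt => Y; rewrite (horner_coef_wide _ sP); apply: eq_bigr => t _.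
  by rewrite -natrX -expnM [(t * _)%N]mulnC.
rewrite alt_sum big1// => t _; rewrite alt_exp_eq0 ?mulr0// => A.
exists <<A>>%MS; last by rewrite genmxE.
by rewrite mem_small_mx// mxrank_gen (leq_ltn_trans (rank_leq_row A))// (leq_trans (ltn_ord t)).
Qed.

End RecursionPolynomial.

(** * Unit matrices and averaging *)

Section UnitMatrices.
Variables (F : finFieldType).

(** Equal kernels make each of [U] and [U'] a right multiple of the other. The multiplier preserves
    the rank of [U], so it can be replaced by an invertible matrix. *)
Lemma eq_ker_unitmx m n (U U' : 'M[F]_(m, n)) :
  (forall x : 'rV_m, x *m U = 0 <-> x *m U' = 0) ->
  exists2 g, g \in unitmx & U *m g = U'.
Proof.
have pinvK (A B : 'M[F]_(m, n)) :
    (forall x : 'rV_m, x *m A = 0 -> x *m B = 0) -> A *m (pinvmx A *m B) = B.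
  move=> AB; apply/eqP; rewrite mulmxA -subr_eq0 -[X in _ - X]mul1mx -mulmxBl.
  apply/eqP/row_matrixP=> i; rewrite row0 row_mul; apply: AB.
  by rewrite -row_mul mulmxBl mul1mx mulmxKpV ?subrr ?row0.
move=> UU'; have UfU' := pinvK _ _ (fun x => (UU' x).1).
have U'fU := pinvK _ _ (fun x => (UU' x).2).
have [|g gu UgU'] := @complete_unitmx F m n U (pinvmx U *m U').
  apply/eqP; rewrite eqn_leq mxrankM_maxl UfU' /=.
  by rewrite -[X in (\rank X <= _)%N]U'fU mxrankM_maxl.
by exists g => //; rewrite -UgU'.
Qed.

Lemma unitmx_compress d c (A : 'M[F]_(d, d + c)) :
  exists2 g, g \in unitmx & exists B : 'M_d, A *m g = B *m row_mx 1%:M 0.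
Proof.
have rd : (\rank A <= d)%N := rank_leq_row A.
have Ab : A *m pinvmx (row_base A) = col_base A.
  by rewrite -[RHS](mulmxKp (row_base_free A)) mulmx_base.
(* [f] sends [row_base A] to the first standard basis vectors. It may be singular but keeps the rank
   of [A], so some unit [g] agrees with it on [A]. *)
pose f : 'M[F]_(d + c) := pinvmx (row_base A) *m pid_mx (\rank A).
have Af : A *m f = col_base A *m pid_mx (\rank A) by rewrite mulmxA Ab.
have [|g gu Ag] := @complete_unitmx F d (d + c) A f.
  apply/eqP; rewrite eqn_leq mxrankM_maxl /= Af.
  rewrite -[X in (X <= _)%N](eqnP (col_base_full A)).
  have cb : col_base A *m (pid_mx (\rank A) : 'M_(_, d + c)) *m
            (pid_mx (\rank A) : 'M_(_, \rank A)) = col_base A.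
    by rewrite -mulmxA pid_mx_id ?(leq_trans rd (leq_addr _ _))// pid_mx_1 mulmx1.
  by rewrite -[X in (\rank X <= _)%N]cb mxrankM_maxl.
exists g => //; exists (col_base A *m pid_mx (\rank A)).
have pJ : (pid_mx (\rank A) : 'M[F]_(\rank A, d)) *m row_mx 1%:M 0 =
          pid_mx (\rank A) :> 'M_(_, d + c).
  by rewrite -pid_mx_row mul_pid_mx (minn_idPl rd) (minn_idPr rd).
by rewrite -Ag Af -[RHS]mulmxA pJ.
Qed.

Section Maschke.
Variables (k : fieldType) (vT : vectType k) (n : nat) (rho : 'M[F]_n -> 'End(vT)).
Hypothesis rho1 : forall x, rho 1%:M x = x.
Hypothesis rhoM : forall g h x, rho g (rho h x) = rho (h *m g) x.
Variable U : {vspace vT}.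
Hypothesis Ust : forall g x, g \in unitmx -> x \in U -> rho g x \in U.

(** The sum of the conjugates of [projv U] is left undivided, so it acts on [U] as the order of the
    group. *)
Lemma maschke_projection : exists p : 'End(vT),
  [/\ forall x, p x \in U,
      forall x, x \in U -> p x = #|[set g : 'M[F]_n | g \in unitmx]|%:R *: x &
      forall h x, h \in unitmx -> p (rho h x) = rho h (p x)].
Proof.
exists (\sum_(g | g \in unitmx) (rho (invmx g) \o projv U \o rho g))%VF; split.
- move=> x; rewrite sum_lfunE memv_suml// => g gu; rewrite !comp_lfunE.
  by rewrite Ust ?unitmx_inv ?memv_proj.
- move=> x xU; rewrite sum_lfunE scaler_nat cardsE -sumr_const; apply: eq_bigr => g gu.
  by rewrite !comp_lfunE projv_id ?Ust// rhoM mulmxV// rho1.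
- move=> h x hu; rewrite !sum_lfunE linear_sum /=.
  rewrite [RHS](reindex (fun g => h *m g)) /=; last first.
    exists (fun g => invmx h *m g) => g _; first by rewrite mulKmx.
    by rewrite mulKVmx.
  apply: eq_big => [g|g gu]; first by rewrite unitmx_mul hu.
  rewrite !comp_lfunE (rhoM g h) (rhoM h); congr (rho _ _).
  have hg : h *m g \in unitmx by rewrite unitmx_mul hu.
  by rewrite -[LHS]mul1mx -(mulVmx hg) -2!mulmxA (mulmxV gu) mulmx1.
Qed.

End Maschke.
End UnitMatrices.

(** * Stabilized coinvariants *)

Section PartialMaps.
Variables (F : finFieldType) (I : finType) (d : nat).

(* Bases of the free module on I generators of degree d and of its stabilized
   coinvariants; the latter also contains non-linear partial maps, on which no
   element of interest is supported. *)
Definition Mt n := (I * 'M[F]_(d, n))%type.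
Definition Lt n := (I * {ffun 'rV[F]_d -> option 'rV[F]_n})%type.
HB.instance Definition _ n := Finite.copy (Mt n) (I * 'M[F]_(d, n))%type.
HB.instance Definition _ n :=
  Finite.copy (Lt n) (I * {ffun 'rV[F]_d -> option 'rV[F]_n})%type.

Definition act n m (f : 'M[F]_(n, m)) (a : Mt n) : Mt m := (a.1, a.2 *m f).

Definition iota n (a : Mt n) : Lt n := (a.1, [ffun v => Some (v *m a.2)]).

(** Orbits under the pointwise stabilizer of [F^j] remember a linear map only on the vectors that it
    sends into [F^j], whence the restriction to the kernel of [g]. *)
Definition tau n j c (f : 'M[F]_(n, j)) (g : 'M[F]_(n, c)) (b : Lt n) : Lt j :=
  (b.1, [ffun v => if b.2 v is Some w then
                     if w *m g == 0 then Some (w *m f) else None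
                   else None]).

(* If (f | g) is injective then tau f g is induced by a morphism of VI: compose
   with F^n -> F^j + F^c, where F^c is then absorbed into the stabilizing summand. *)
Definition jointly_free n j c (f : 'M[F]_(n, j)) (g : 'M[F]_(n, c)) :=
  forall v : 'rV_n, v *m f = 0 -> v *m g = 0 -> v = 0.

Lemma row_freeP n m (A : 'M[F]_(n, m)) :
  (forall v : 'rV_n, v *m A = 0 -> v = 0) -> row_free A.
Proof.
move=> A0; rewrite -kermx_eq0; apply/eqP/row_matrixP=> i; rewrite row0.
by apply: A0; rewrite -row_mul mulmx_ker row0.
Qed.

Lemma jointly_free_row_free n j c (f : 'M[F]_(n, j)) (g : 'M[F]_(n, c)) :
  jointly_free f g -> row_free (row_mx f g).
Proof.
move=> fg; apply: row_freeP => v; rewrite mul_mx_row => /eqP.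
by rewrite row_mx_eq0 => /andP[/eqP vf /eqP vg]; exact: fg.
Qed.

Lemma row_free_jointly_free n m c (f : 'M[F]_(n, m)) (g : 'M[F]_(n, c)) :
  row_free f -> jointly_free f g.
Proof. by move=> /row_free_inj finj v vf _; apply: finj; rewrite vf mul0mx. Qed.

Lemma tau_tau n j c j' c' (f : 'M_(n, j)) (g : 'M_(n, c))
    (f' : 'M_(j, j')) (g' : 'M_(j, c')) b :
  tau f' g' (tau f g b) = tau (f *m f') (row_mx g (f *m g')) b.
Proof.
congr (_, _); apply/ffunP=> v; rewrite !ffunE.
case: (b.2 v) => // w; rewrite mul_mx_row row_mx_eq0.
by case: eqP => //= _; rewrite !mulmxA.
Qed.

Lemma tau_iota_act n m j c (h : 'M_(n, m)) (f : 'M_(m, j)) (g : 'M_(m, c)) a :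
  tau f g (iota (act h a)) = tau (h *m f) (h *m g) (iota a).
Proof. by congr (_, _); apply/ffunP=> v; rewrite !ffunE !mulmxA. Qed.

Lemma jointly_free_comp n j c j' c' (f : 'M_(n, j)) (g : 'M_(n, c))
    (f' : 'M_(j, j')) (g' : 'M_(j, c')) :
  jointly_free f g -> jointly_free f' g' ->
  jointly_free (f *m f') (row_mx g (f *m g')).
Proof.
move=> fg fg' v vff' /eqP; rewrite mul_mx_row row_mx_eq0 => /andP[/eqP vg /eqP vfg'].
by apply: fg => //; apply: fg'; rewrite -mulmxA.
Qed.

Lemma tau_row0 n j c e (f : 'M_(n, j)) (g : 'M_(n, c)) :
  tau f (row_mx g (0 : 'M_(n, e))) =1 tau f g.
Proof.
move=> b; congr (_, _); apply/ffunP=> v; rewrite !ffunE; case: (b.2 v) => // w.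
by rewrite mul_mx_row row_mx_eq0 mulmx0 eqxx andbT.
Qed.

Lemma iota_act n m (f : 'M_(n, m)) a : iota (act f a) = tau f (0 : 'M_(n, 0)) (iota a).
Proof. by congr (_, _); apply/ffunP=> v; rewrite !ffunE mulmx0 eqxx mulmxA. Qed.

Lemma tau1 n b : tau 1%:M (0 : 'M_(n, 0)) b = b.
Proof.
case: b => i b; congr (_, _); apply/ffunP=> v; rewrite !ffunE /=.
by case: (b v) => // w; rewrite mulmx0 eqxx mulmx1.
Qed.

Lemma iota_inj n : injective (@iota n).
Proof.
move=> [i A] [j B] [-> /ffunP AB]; congr (_, _).
by apply/row_matrixP=> r; have := AB (delta_mx 0 r); rewrite !ffunE -!rowE => -[].
Qed.

Definition proj1 n c : 'M[F]_(n + c, n) := col_mx 1%:M 0.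
Definition proj2 n c : 'M[F]_(n + c, c) := col_mx 0 1%:M.

Lemma jointly_free_proj n c : jointly_free (proj1 n c) (proj2 n c).
Proof.
move=> v; rewrite -(hsubmxK v) !mul_row_col !mulmx1 !mulmx0 addr0 add0r.
by move=> -> ->; rewrite row_mx0.
Qed.

Lemma row_mx_proj1 m n c (A : 'M_(m, n)) (B : 'M_(m, c)) : row_mx A B *m proj1 n c = A.
Proof. by rewrite mul_row_col mulmx1 mulmx0 addr0. Qed.

Lemma row_mx_proj2 m n c (A : 'M_(m, n)) (B : 'M_(m, c)) : row_mx A B *m proj2 n c = B.
Proof. by rewrite mul_row_col mulmx1 mulmx0 add0r. Qed.

Variable k : fieldType.
Notation free B := {ffun B -> k^o}.

Definition VI_stable (K : forall n, {vspace free (Mt n)}) :=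
  forall n m (f : 'M[F]_(n, m)) x, row_free f -> x \in K n -> pusht k (act f) x \in K m.

Variable K : forall n, {vspace free (Mt n)}.
Hypothesis Kst : VI_stable K.

Definition Uimg n c : {vspace free (Lt n)} :=
  (pusht k (tau (proj1 n c) (proj2 n c) \o @iota _) @: K (n + c))%VS.

Lemma mem_Uimg N n c (f : 'M_(N, n)) (g : 'M_(N, c)) w : jointly_free f g ->
  w \in K N -> pusht k (tau f g \o @iota _) w \in Uimg n c.
Proof.
move=> fg wK; apply/memv_imgP; exists (pusht k (act (row_mx f g)) w).
  by apply: Kst => //; exact: jointly_free_row_free.
by apply/esym/pusht_compE => a /=; rewrite tau_iota_act row_mx_proj1 row_mx_proj2.
Qed.

(** Appending zero columns to [g] raises [c] without changing [tau f g]. *)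
Lemma Uimg_mono n c c' : (c <= c')%N -> (Uimg n c <= Uimg n c')%VS.
Proof.
move=> /subnKC <-; apply/subvP=> _ /memv_imgP[w wK ->].
have -> : pusht k (tau (proj1 n c) (proj2 n c) \o @iota _) =
  pusht k (tau (proj1 n c) (row_mx (proj2 n c) (0 : 'M_(_, c' - c))) \o @iota _).
  by apply: eq_pusht => a /=; rewrite tau_row0.
apply: mem_Uimg => // v v1 /eqP; rewrite mul_mx_row row_mx_eq0 => /andP[/eqP v2 _].
exact: (jointly_free_proj v1).
Qed.

(** The images increase with [c] inside a finite-dimensional space, so they become constant; [LK n]
    is the limit. *)
Lemma exists_stable_image : exists LK : forall n, {vspace free (Lt n)},
  (forall n c, (Uimg n c <= LK n)%VS) /\
  (forall n, exists c0, forall c, (c0 <= c)%N -> LK n = Uimg n c).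
Proof.
have ex n : exists U, exists c0, forall c, (c0 <= c)%N -> U = Uimg n c.
  have [c0 c0P] := vspace_chain_stable (@Uimg_mono n).
  by exists (Uimg n c0), c0 => c /c0P ->.
exists (fun n => sval (constructive_indefinite_description _ (ex n))).
split=> n; case: (constructive_indefinite_description _ (ex n)) => U /= [c0 UP].
  by move=> c; rewrite (UP (maxn c0 c)) ?leq_maxl// Uimg_mono// leq_maxr.
by exists c0.
Qed.

Variable LK : forall n, {vspace free (Lt n)}.
Hypothesis LKsup : forall n c, (Uimg n c <= LK n)%VS.
Hypothesis LKst : forall n, exists c0, forall c, (c0 <= c)%N -> LK n = Uimg n c.

Lemma mem_LK N n c (f : 'M_(N, n)) (g : 'M_(N, c)) w : jointly_free f g ->
  w \in K N -> pusht k (tau f g \o @iota _) w \in LK n.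
Proof. by move=> fg wK; apply: (subvP (LKsup n c)); exact: mem_Uimg. Qed.

Lemma LK_ex n x : x \in LK n -> exists c, exists2 w, w \in K (n + c) &
  x = pusht k (tau (proj1 n c) (proj2 n c) \o @iota _) w.
Proof.
by have [c /(_ c (leqnn _)) ->] := LKst n; move=> /memv_imgP[w wK ->]; exists c, w.
Qed.

Lemma LK_tau n j c (f : 'M_(n, j)) (g : 'M_(n, c)) x : jointly_free f g ->
  x \in LK n -> pusht k (tau f g) x \in LK j.
Proof.
move=> fg /LK_ex[e [w wK ->]]; rewrite pusht_comp.
rewrite (eq_pusht k (g := tau (proj1 n e *m f) (row_mx (proj2 n e) (proj1 n e *m g)) \o @iota _)).
  apply: mem_LK wK; apply: jointly_free_comp => //; exact: jointly_free_proj.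
by move=> a /=; rewrite tau_tau.
Qed.

(** The idempotent e_Y, since the kernel of [cokermx Y] is the row space of [Y]. *)
Definition res n (Y : 'M[F]_n) : Lt n -> Lt n := tau 1%:M (cokermx Y).
Definition lres n (Y : 'M[F]_n) := pusht k (res Y).

Lemma resE n (Y : 'M[F]_n) b : res Y b =
  (b.1, [ffun v => if b.2 v is Some w then if (w <= Y)%MS then Some w else None else None]).
Proof.
congr (_, _); apply/ffunP=> v; rewrite !ffunE; case: (b.2 v) => // w.
by rewrite mulmx1 submxE.
Qed.

Lemma lresE n (Y : 'M[F]_n) : lres Y = pusht k (tau 1%:M (cokermx Y)).
Proof. by []. Qed.

Lemma lres_dlt n (Y : 'M[F]_n) b : lres Y (dlt k b) = dlt k (res Y b).
Proof. exact: pusht_dlt. Qed.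

(* Unification would otherwise unfold cokermx and capmx. *)
#[local] Opaque res.

Lemma eq_lres n (Y Z : 'M[F]_n) : (Y :=: Z)%MS -> lres Y = lres Z.
Proof.
move=> YZ; apply: eq_pusht => b; rewrite (resE Y) (resE Z); congr pair.
by apply/ffunP=> v; rewrite !ffunE; case: (b.2 v) => // w; rewrite YZ.
Qed.

Lemma lres_comp n (Y Z : 'M[F]_n) x : lres Z (lres Y x) = lres (Y :&: Z)%MS x.
Proof.
apply: pusht_compE => b; rewrite (resE Y) (resE Z) (resE (Y :&: Z)%MS) /=.
congr pair; apply/ffunP=> v; rewrite !ffunE; case: (b.2 v) => // w.
by rewrite sub_capmx; case: (w <= Y)%MS.
Qed.

#[local] Opaque lres.

Lemma lres_id n (Y : 'M[F]_n) x : lres Y (lres Y x) = lres Y x.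
Proof.
rewrite [LHS]lres_comp (eq_lres (Z := Y)) => [//|].
by apply/eqmxP; rewrite capmxSl sub_capmx !submx_refl.
Qed.

Lemma lres_LK n (Y : 'M[F]_n) x : x \in LK n -> lres Y x \in LK n.
Proof. by rewrite lresE; apply: LK_tau => v; rewrite mulmx1. Qed.

Lemma dim_lres_LK n (Y : 'M[F]_n) : \dim (lres Y @: LK n) = \dim (LK (\rank Y)).
Proof.
(* [up] embeds along a basis of [Y]; [down] discards values outside [Y] and takes coordinates in
   this basis. They identify [LK (\rank Y)] with the image of [lres Y]. *)
pose R := row_base Y; have Rfree : row_free R := row_base_free Y.
pose up := pusht k (tau R (0 : 'M_(_, 0))).
pose down := pusht k (tau (pinvmx R) (cokermx Y)).
have upLK x : x \in LK (\rank Y) -> up x \in LK n.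
  by apply: LK_tau; exact: row_free_jointly_free.
have downLK x : x \in LK n -> down x \in LK (\rank Y).
  apply: LK_tau => v vR /eqP; rewrite -submxE -(eq_row_base Y) => vY.
  by rewrite -(mulmxKpV vY) vR mul0mx.
have upK x : down (up x) = x.
  rewrite pusht_comp; apply: pusht_id => -[i b]; congr (_, _); apply/ffunP=> v.
  rewrite !ffunE /=; case: (b v) => // w; rewrite mulmx0 eqxx -submxE.
  by rewrite (submx_trans (submxMl w R)) ?eq_row_base// mulmxKp.
have downK x : up (down x) = lres Y x.
  rewrite lresE; apply: pusht_compE => -[i b] /=.
  congr (_, _); apply/ffunP=> v; rewrite !ffunE /=; case: (b v) => // w.
  rewrite -submxE; case: ifP => // wY; rewrite mulmx0 eqxx mulmx1 mulmxKpV//.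
  by rewrite eq_row_base.
rewrite -[RHS](@dim_img_cancel _ _ _ up down) //; congr (\dim _).
apply/eqP; rewrite eqEsubv; apply/andP; split; apply/subvP=> _ /memv_imgP[x xLK ->].
  by rewrite -downK memv_img// downLK.
by rewrite -[x]upK downK memv_img// upLK.
Qed.

Lemma dim_LK_polynomial :
  exists P : {poly rat}, forall n, P.[(#|F| ^ n)%:R] = (\dim (LK n))%:R.
Proof.
apply: (@alt_recursion_polynomial F d) => n ltdn.
rewrite (eq_alt (g' := fun Y => (\dim (lres Y @: LK n))%:R)); last first.
  by move=> Y; rewrite dim_lres_LK.
rewrite (@alt_dim k (free (Lt n)) F n (@lres n)); last first.
- exact: lres_LK.
- exact: lres_id.
- exact: lres_comp.
suff -> : (cores (@lres n) (small_mx F n) 1%:M @: LK n = 0)%VS by rewrite dimv0.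
apply/eqP; rewrite -subv0; apply/subvP=> _ /memv_imgP[_ /LK_ex[c [w _ ->]] ->].
rewrite memv0 -[X in X == 0]comp_lfunE; set G := (_ \o _)%VF.
suff -> : G = 0 by rewrite zero_lfunE.
apply: lfun_dltP => -[i A]; rewrite zero_lfunE comp_lfunE pusht_dlt.
(* All values of this partial map lie in the row space of [A *m proj1 n c], of rank at most [d < n];
   the factor of that subspace kills the basis vector. *)
apply: (@cores_eq0 k _ F n (@lres n) (@lres_comp n) <<A *m proj1 n c>>%MS).
  by rewrite mem_small_mx// mxrank_gen (leq_ltn_trans (rank_leq_row _)).
rewrite lres_dlt resE /=; congr (dlt _ (_, _)); apply/ffunP=> v; rewrite !ffunE.
by case: ifP => // _; rewrite genmxE -mulmxA submxMl.
Qed.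

(** * Saturation in high degrees *)

Definition fixes_base c (h : 'M[F]_(d + c)) :=
  (h \in unitmx) && (row_mx 1%:M 0 *m h == row_mx 1%:M 0 :> 'M_(d, _)).

Definition corner c : Mt (d + c) -> Lt d := fun a => tau (proj1 d c) (proj2 d c) (iota a).

Lemma act_act n m p (f : 'M_(n, m)) (g : 'M_(m, p)) a : act g (act f a) = act (f *m g) a.
Proof. by congr (_, _); rewrite /= mulmxA. Qed.

(** A relation [u + v *m A = 0] with [u] in [F^d] puts [v *m A] in [F^d], and there the corner
    records its value. *)
Lemma corner_ker c (A A' : 'M[F]_(d, d + c)) i :
  corner (i, A) = corner (i, A') ->
  forall x : 'rV_(d + d), x *m col_mx (row_mx 1%:M 0) A = 0 ->
    x *m col_mx (row_mx 1%:M 0) A' = 0.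
Proof.
case=> /ffunP AA' x; rewrite -(hsubmxK x) !mul_row_col.
set u := lsubmx x; set v := rsubmx x => uv0; move: (AA' v); rewrite !ffunE.
have vp2 : v *m A *m proj2 d c = 0.
  have := congr1 (mulmx^~ (proj2 d c)) uv0.
  by rewrite mulmxDl -mulmxA row_mx_proj2 mulmx0 add0r mul0mx.
have up1 : u + v *m A *m proj1 d c = 0.
  have := congr1 (mulmx^~ (proj1 d c)) uv0.
  by rewrite mulmxDl -mulmxA row_mx_proj1 mulmx1 mul0mx.
rewrite vp2 eqxx; case: eqP => // vp2' [vp1].
apply: (@jointly_free_proj d c); rewrite mulmxDl -mulmxA ?row_mx_proj1 ?row_mx_proj2.
  by rewrite mulmx1 -vp1.
by rewrite mulmx0 vp2' addr0.
Qed.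

(* The fibres of the projection to level d are the orbits of the pointwise
   stabilizer of F^d in GL_(d + c). *)
Lemma corner_orbit c (a a' : Mt (d + c)) : corner a = corner a' ->
  exists2 h, fixes_base h & act h a = a'.
Proof.
case: a a' => [i A] [i' A'] aa'; have ii' : i = i' by case: aa'.
rewrite -ii' in aa' *.
have [|h hu] := @eq_ker_unitmx F _ _ (col_mx (row_mx 1%:M 0) A) (col_mx (row_mx 1%:M 0) A').
  by move=> x; split; [exact: corner_ker aa' x | exact: corner_ker (esym aa') x].
rewrite mul_col_mx => /eq_col_mx[hJ hA].
by exists h; rewrite /fixes_base ?hu ?hJ//= /act /= hA.
Qed.

(** The sum over the stabilizer is constant on its orbits, the fibres of [corner], so only the fibre
    totals of the coefficients matter. *)
Lemma sum_fixes_base c (y z : free (Mt (d + c))) :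
  pusht k (@corner c) y = pusht k (@corner c) z ->
  \sum_(h | fixes_base h) pusht k (act h) y = \sum_(h | fixes_base h) pusht k (act h) z.
Proof.
move=> yz; pose S a := \sum_(h | @fixes_base c h) dlt k (act h a).
have SE x : \sum_(h | @fixes_base c h) pusht k (act h) x = \sum_a x a *: S a.
  under [RHS]eq_bigr do rewrite scaler_sumr.
  rewrite [RHS]exchange_big /=; apply: eq_bigr => h _.
  rewrite {1}(ffun_sum_dlt x) linear_sum; apply: eq_bigr => a _.
  by rewrite linearZ /= pusht_dlt.
have Scorner a a' : corner a = corner a' -> S a = S a'.
  case/corner_orbit=> h0 /andP[h0u /eqP h0J] <-; rewrite /S.
  rewrite [LHS](reindex (fun h => h0 *m h)) /=; last first.
    by exists (fun h => invmx h0 *m h) => h _; rewrite ?mulKmx ?mulKVmx.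
  apply: eq_big => [h|h _]; last by rewrite act_act.
  by rewrite /fixes_base unitmx_mul h0u mulmxA h0J.
rewrite !SE; apply/eqP; rewrite -subr_eq0 -sumrB; apply/eqP.
rewrite (partition_big (@corner c) predT) //= big1// => b _.
case: (pickP (fun a : Mt (d + c) => corner a == b)) => [a0 /eqP a0b|nob]; last first.
  by rewrite big1// => a; rewrite nob.
rewrite (eq_bigr (fun a => (y a - z a) *: S a0)); last first.
  by move=> a /eqP ab; rewrite -scalerBl (Scorner a a0)// ab.
rewrite -scaler_suml sumrB.
have /ffunP/(_ b) := yz; rewrite !pushE => yzb.
suff -> : \sum_(a | corner a == b) y a = \sum_(a | corner a == b) z a by rewrite subrr scale0r.
move: yzb; under eq_bigl do rewrite (inj_eq Some_inj).
by under [RHS]eq_bigl do rewrite (inj_eq Some_inj).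
Qed.

Lemma act_unit_inj n (g : 'M[F]_n) : g \in unitmx -> injective (@act n n g).
Proof. by move=> gu [i A] [j B] [-> /(can_inj (mulmxK gu)) ->]. Qed.

Hypothesis char0 : [pchar k] =i pred0.

Lemma natr_card_neq0 (T : finType) (A : {set T}) x : x \in A -> #|A|%:R != 0 :> k.
Proof.
move=> xA; have /pcharf0P -> := char0.
by rewrite cards_eq0; apply/set0Pn; exists x.
Qed.

(* For x in the saturation the sum over the stabilizer of F^d lies in K.  After
   subtracting an equivariant projection onto K this sum vanishes, and its
   coordinates at matrices (B | 0), which the stabilizer fixes, are multiples of
   those of x; every GL-orbit of matrices contains such a (B | 0). *)
Lemma saturation_eventually :
  exists c0, forall c, (c0 <= c)%N ->
    forall x, pusht k (@iota (d + c)) x \in LK (d + c) -> x \in K (d + c).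
Proof.
have [c0 LKd] := LKst d; exists c0 => c /LKd LKdE {c0 LKd}.
pose T x := pusht k (@iota (d + c)) x \in LK (d + c).
pose rho (g : 'M_(d + c)) := pusht k (@act _ _ g).
have rho1 x : rho 1%:M x = x by apply: pusht_id => -[i A]; rewrite /act /= mulmx1.
have rhoM g h x : rho g (rho h x) = rho (h *m g) x.
  by apply: pusht_compE => a; rewrite act_act.
have KT x : x \in K (d + c) -> T x.
  move=> xK; rewrite /T (eq_pusht k (g := tau 1%:M (0 : 'M_(_, 0)) \o @iota (d + c))).
    by apply: mem_LK => // v; rewrite mulmx1.
  by move=> a; rewrite /= tau1.
have Kst' g x : g \in unitmx -> x \in K (d + c) -> rho g x \in K (d + c).
  by move=> gu; apply: Kst; rewrite row_free_unit.
have Trho g x : g \in unitmx -> T x -> T (rho g x).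
  move=> gu Tx; rewrite /T.
  rewrite (pusht_compE (h := tau g (0 : 'M_(_, 0)) \o @iota _)); last exact: iota_act.
  rewrite -(pusht_comp (tau g (0 : 'M_(_, 0)))).
  by apply: LK_tau Tx; apply: row_free_jointly_free; rewrite row_free_unit.
have TB x y : T x -> T y -> T (x - y) by rewrite /T linearB /=; exact: rpredB.
have TZ a x : T x -> T (a *: x) by rewrite /T linearZ /=; exact: rpredZ.
(* The image of [x] at level [d] lies in [LK d], which is already attained at stage [c]; so some [z]
   in [K] has the same corner, hence the same sum. *)
have Tsum x : T x -> \sum_(h | fixes_base h) rho h x \in K (d + c).
  move=> Tx.
  have : pusht k (@corner c) x \in LK d.
    rewrite -(pusht_comp (tau (proj1 d c) (proj2 d c)) (@iota _)).
    by apply: LK_tau Tx; exact: jointly_free_proj.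
  rewrite LKdE => /memv_imgP[z zK /sum_fixes_base ->].
  by rewrite memv_suml// => h /andP[hu _]; exact: Kst'.
have [p [pK pid prho]] := maschke_projection rho1 rhoM Kst'.
set N := #|_|%:R in pid; have N0 : N != 0.
  by apply: (@natr_card_neq0 _ _ 1%:M); rewrite inE unitmx1.
(* The sum lies in [K], where [p] is multiplication by [N], yet equivariance makes [p] kill it. *)
have Tsum0 x : T x -> p x = 0 -> \sum_(h | fixes_base h) rho h x = 0.
  move=> Tx px; apply/eqP; rewrite -[_ == 0]/(false || _) -(negPf N0) -scaler_eq0.
  rewrite -pid ?Tsum// linear_sum big1//= => h /andP[hu _].
  by rewrite prho// px linear0.
have T0 x : T x -> p x = 0 -> x = 0.
  move=> Tx px; apply/ffunP=> -[i A]; rewrite [RHS]ffunE.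
  have [g gu [B AgB]] := unitmx_compress A.
  have rhoE h y a : h \in unitmx -> rho h y (act h a) = y a.
    by move=> hu; apply: pusht_inj; exact: act_unit_inj.
  rewrite -(rhoE g x (i, A) gu) /act /= AgB; set y := rho g x.
  have Ty : T y by exact: Trho.
  have py : p y = 0 by rewrite prho// px linear0.
  set a : Mt (d + c) := (i, _).
  have /ffunP/(_ a) := Tsum0 y Ty py; rewrite sum_ffunE [RHS]ffunE.
  rewrite (eq_bigr (fun=> y a)) => [|h /andP[hu /eqP hJ]]; last first.
    by rewrite -[RHS](rhoE h)// /act /= -mulmxA hJ.
  rewrite sumr_const -[y a *+ _]mulr_natl => /eqP.
  rewrite mulf_eq0 => /orP[|/eqP//].
  have fix1 : 1%:M \in [set h | @fixes_base c h].
    by rewrite inE /fixes_base unitmx1 mulmx1 eqxx.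
  by rewrite -cardsE (negPf (natr_card_neq0 fix1)).
(* As [p] is multiplication by [N] on [K], it kills the saturated element [N *: x - p x], which is
   therefore zero. *)
move=> x Tx; have := T0 (N *: x - p x).
have Ty : T (N *: x - p x) by apply: TB; [exact: TZ | apply: KT].
have py : p (N *: x - p x) = 0 by rewrite linearB linearZ /= (pid (p x))// subrr.
move=> /(_ Ty py) /eqP; rewrite subr_eq0 => /eqP Nx.
by rewrite -[x](scalerK N0) Nx rpredZ.
Qed.

End PartialMaps.

(** * Reduction of the degree *)

Section DegreeReduction.
Variables (F : finFieldType) (I : finType) (e : nat) (k : fieldType).
Notation free B := {ffun B -> k^o}.
Notation J := (I * 'M[F]_(e, e.+1))%type.

(* A proper subspace of F^(e.+1) is recorded by e spanning rows C, and a partial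
   map on it by its values on these rows; total maps are sent to None. *)
Definition proper_part n (b : Lt F I e.+1 n) : option (Mt F J e n) :=
  if [pick C : 'M[F]_(e, e.+1) | [forall v, (v <= C)%MS == (b.2 v != None)]] is Some C
  then Some ((b.1, C), \matrix_j odflt 0 (b.2 (row j C))) else None.

(** The domain is given as the kernel of [H]; this singles out the linear elements of [Lt]. *)
Definition partial_linear n (b : Lt F I e.+1 n) := exists c (H : 'M[F]_(e.+1, c))
  (B : 'M[F]_(e.+1, n)), forall v, b.2 v = if v *m H == 0 then Some (v *m B) else None.

Lemma partial_linear_tau N n c (f : 'M[F]_(N, n)) (g : 'M[F]_(N, c)) a :
  partial_linear (tau f g (iota a)).
Proof.
by exists c, (a.2 *m g), (a.2 *m f) => v; rewrite !ffunE !mulmxA.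
Qed.

Lemma proper_part_tau n m (f : 'M[F]_(n, m)) b :
  proper_part (tau f (0 : 'M_(n, 0)) b) = omap (act f) (proper_part b).
Proof.
rewrite /proper_part; set b' := tau _ _ _.
have b'E v : b'.2 v = omap (mulmx^~ f) (b.2 v).
  by rewrite ffunE; case: (b.2 v) => // w; rewrite mulmx0 eqxx.
(* Composing with [f] keeps the domain, so both sides pick the same [C]. *)
rewrite (eq_pick (Q := fun C => [forall v, (v <= C)%MS == (b.2 v != None)])); last first.
  by move=> C; apply: eq_forallb => v; rewrite b'E; case: (b.2 v).
case: pickP => //= C _; congr (Some (_, _)); apply/row_matrixP=> j.
rewrite row_mul !rowK b'E; case: (b.2 _) => //=; by rewrite mul0mx.
Qed.

Lemma proper_part_iota n (a : Mt F I e.+1 n) : proper_part (iota a) = None.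
Proof.
rewrite /proper_part; case: pickP => // C /forallP domC.
have : (1%:M <= C)%MS.
  by apply/row_subP=> i; have := domC (row i 1%:M); rewrite ffunE => /eqP ->.
by move/mxrankS; rewrite mxrank1 leqNgt ltnS rank_leq_row.
Qed.

Lemma proper_part_None n (b : Lt F I e.+1 n) : partial_linear b ->
  proper_part b = None -> exists a, iota a = b.
Proof.
case=> c [H [B bE]]; rewrite /proper_part; case: pickP => // noC _.
have bdom v : (b.2 v != None) = (v <= kermx H)%MS.
  by rewrite bE sub_kermx; case: ifP.
(* A domain of rank at most [e] is spanned by a basis padded with zero rows to [e] rows, which
   [pick] would have found; otherwise the domain is everything. *)
have [rH|rH] := leqP (\rank (kermx H)) e.
  pose C : 'M[F]_(e, e.+1) := pid_mx (\rank (kermx H)) *m row_base (kermx H).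
  case/negP: (negbT (noC C)); apply/forallP=> v; rewrite bdom eqmxMfull ?eq_row_base//.
  by rewrite /row_full rank_pid_mx.
have H0 : H = 0.
  have /sub_kermxP : (1%:M <= kermx H)%MS.
    by rewrite sub1mx /row_full eqn_leq rank_leq_row.
  by rewrite mul1mx.
exists (b.1, B); case: b bE {noC bdom} => i b /= bE; congr (_, _); apply/ffunP=> v.
by rewrite ffunE bE H0 mulmx0 eqxx.
Qed.

(** The rows of the common [C] span both domains, and the two linear maps agree on them. *)
Lemma proper_part_inj n (b b' : Lt F I e.+1 n) m :
  partial_linear b -> partial_linear b' ->
  proper_part b = Some m -> proper_part b' = Some m -> b = b'.
Proof.
case=> c [H [B bE]] [c' [H' [B' bE']]]; rewrite /proper_part.
case: pickP => // C /forallP domC [<-]; case: pickP => // C' /forallP domC' [ib CC'].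
rewrite {}CC' {C'} in domC' * => /row_matrixP BB'.
case: b b' ib bE bE' domC domC' BB' => [i b] [i' b'] /= <- bE bE' domC domC' BB'.
congr (_, _); apply/ffunP=> v.
have CBB' : C *m B = C *m B'.
  apply/row_matrixP=> j; have := BB' j; rewrite !rowK !row_mul.
  have := domC (row j C); have := domC' (row j C); rewrite row_sub bE bE'.
  by case: ifP => // _ _; case: ifP => // _ _ /= ->.
have := domC v; have := domC' v; rewrite bE bE'.
case: (boolP (v <= C)%MS) => [/submxP[w ->]|_]; last by do 2 case: ifP.
by case: ifP => // _ _; case: ifP => // _ _; rewrite -!mulmxA CBB'.
Qed.

(** [proper_part] is injective where it is defined on linear partial maps, so each coefficient of
    [x] at a proper domain survives in the image and must vanish. *)
Lemma kernel_proper_part n (x : free (Lt F I e.+1 n)) :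
  (forall b, x b != 0 -> partial_linear b) -> push k (@proper_part n) x = 0 ->
  exists y, x = pusht k (@iota F I e.+1 n) y.
Proof.
move=> xlin px; exists [ffun a => x (iota a)]; apply/ffunP=> b.
case: (pickP (fun a => iota a == b)) => [a /eqP <-|nob].
  by rewrite (pusht_inj (@iota_inj _ _ _ _)) ffunE.
rewrite pushE big1 => [|a]; last by rewrite (inj_eq Some_inj) nob.
apply/eqP/negP => /negP xb; have blin := xlin b xb.
case pb: (proper_part b) => [m|]; last first.
  by have [a ab] := proper_part_None blin pb; have := nob a; rewrite ab eqxx.
have /ffunP/(_ m) := px; rewrite pushE ffunE (bigD1 b) ?pb//= big1 ?addr0.
  by move=> xb0; rewrite xb0 eqxx in xb.
move=> b' /andP[/eqP pb' b'b]; apply/eqP/negP => /negP /xlin b'lin.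
by rewrite (proper_part_inj b'lin blin pb' pb) eqxx in b'b.
Qed.

Hypothesis char0 : [pchar k] =i pred0.
Variable K : forall n, {vspace free (Mt F I e.+1 n)}.
Hypothesis Kst : VI_stable K.

Lemma degree_reduction : exists (P : {poly rat}) N
    (K' : forall n, {vspace free (Mt F J e n)}), VI_stable K' /\
  forall n, (N <= n)%N -> P.[(#|F| ^ n)%:R] = (\dim (K n) + \dim (K' n))%:R.
Proof.
have [LK [LKsup LKst]] := exists_stable_image Kst.
have [P PLK] := dim_LK_polynomial Kst LKsup LKst.
have [c0 sat] := saturation_eventually Kst LKsup LKst char0.
(* From this threshold on [n = e.+1 + c] with [c0 <= c], so saturation identifies the kernel of the
   projection on [LK n] with [K n]; rank-nullity concludes. *)
exists P, (e.+1 + c0)%N, (fun n => (push k (@proper_part n) @: LK n)%VS); split.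
  move=> n m f _ ffree /memv_imgP[x xLK ->].
  have -> : pusht k (act f) (push k (@proper_part n) x) =
            push k (@proper_part m) (pusht k (tau f (0 : 'M_(n, 0))) x).
    rewrite -[LHS]comp_lfunE -[RHS]comp_lfunE; congr (fun_of_lfun _ _).
    apply: lfun_dltP => b; rewrite !comp_lfunE pusht_dlt !push_dlt proper_part_tau.
    by case: (proper_part b) => [m'|]/=; rewrite ?linear0// pusht_dlt.
  apply: memv_img; apply: (LK_tau Kst LKsup LKst) xLK.
  exact: row_free_jointly_free.
move=> n leNn; have led : (e.+1 <= n)%N by rewrite (leq_trans _ leNn)// leq_addr.
have lec : (c0 <= n - e.+1)%N by rewrite leq_subRL.
rewrite -(subnKC led) {leNn led}; set c := (n - _)%N in lec *; set m := (_ + c)%N.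
rewrite PLK -(limg_ker_dim (push k (@proper_part m)) (LK m)).
congr ((_ + _)%:R); rewrite -(@limg_dim_eq _ _ _ (pusht k (@iota F I e.+1 m))); last first.
  apply/eqP; rewrite -subv0; apply/subvP=> x; rewrite memv_cap memv_ker memv0.
  case/andP=> _ /eqP x0; apply/eqP/ffunP=> a.
  by rewrite -(pusht_inj (@iota_inj F I e.+1 m) x) x0 !ffunE.
congr (\dim _); apply/eqP; rewrite eqEsubv; apply/andP; split; apply/subvP=> x.
  rewrite memv_cap memv_ker => /andP[xLK /eqP px].
  have [b xb|y xy] := kernel_proper_part _ px.
    have [c' [w _ xw]] := LK_ex LKst xLK.
    case: (pickP (fun a => (tau (proj1 F m c') (proj2 F m c') \o @iota F I _ _) a == b)).
      by move=> a /eqP <-; exact: partial_linear_tau.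
    move=> nob; case/eqP: xb; rewrite xw pushE big1// => a.
    by rewrite (inj_eq Some_inj) nob.
  by rewrite xy memv_img// (sat c lec)// -xy.
case/memv_imgP=> y yK ->; rewrite memv_cap memv_ker; apply/andP; split.
  rewrite (eq_pusht k (g := tau 1%:M (0 : 'M_(_, 0)) \o @iota F I e.+1 m)).
    by apply: (mem_LK Kst LKsup) yK => v; rewrite mulmx1.
  by move=> a; rewrite /= tau1.
rewrite push_pusht (eq_push k (g := fun=> None)) => [|a]; last exact: proper_part_iota.
by apply/eqP/ffunP=> m'; rewrite pushE big1// ffunE.
Qed.

End DegreeReduction.

(** * Dimensions of submodules of free modules, by induction on the degree *)

Section SubmoduleDimensions.
Variables (F : finFieldType) (k : fieldType).
Hypothesis char0 : [pchar k] =i pred0.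
Notation free B := {ffun B -> k^o}.

Lemma dim_free (B : finType) : dim (free B) = #|B|.
Proof. exact: muln1. Qed.

Lemma row_free_pid n m : (n <= m)%N -> row_free (pid_mx n : 'M[F]_(n, m)).
Proof. by move=> lenm; rewrite /row_free rank_pid_mx. Qed.

Lemma act_inj (I : finType) d n m (f : 'M[F]_(n, m)) :
  row_free f -> injective (@act F I d n m f).
Proof. by move=> ff [i A] [j B] [-> /(row_free_inj ff) ->]. Qed.

Lemma pusht_lker0 (A B : finType) (f : A -> B) (U : {vspace free A}) :
  injective f -> (U :&: lker (pusht k f) = 0)%VS.
Proof.
move=> finj; apply/eqP; rewrite -subv0; apply/subvP=> x.
rewrite memv_cap memv_ker memv0 => /andP[_ /eqP x0]; apply/eqP/ffunP=> a.
by rewrite -(pusht_inj finj x) x0 !ffunE.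
Qed.

Lemma dim_submodule_mono (I : finType) d (K : forall n, {vspace free (Mt F I d n)}) :
  VI_stable K -> forall n m, (n <= m)%N -> (\dim (K n) <= \dim (K m))%N.
Proof.
move=> Kst n m lenm; have ff := row_free_pid lenm.
rewrite -(limg_dim_eq (pusht_lker0 (K n) (@act_inj I d _ _ _ ff))).
by apply: dimvS; apply/subvP=> _ /memv_imgP[x xK ->]; exact: Kst.
Qed.

Lemma dim_submodule (I : finType) d (K : forall n, {vspace free (Mt F I d n)}) :
  VI_stable K -> exists (P : {poly rat}) N, forall n, (N <= n)%N ->
    P.[(#|F| ^ n)%:R] = (\dim (K n))%:R.
Proof.
elim: d I K => [|d IHd] I K Kst; last first.
  (* The reduction lowers the degree but enlarges the index set, so the induction ranges over all
     [I]. *)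
  have [P [N [K' [/IHd[P' [N' PN']] PN]]]] := degree_reduction char0 Kst.
  exists (P - P'), (maxn N N') => n; rewrite geq_max => /andP[leN leN'].
  by rewrite hornerD hornerN PN// PN'// natrD addrK.
(* In degree zero the dimensions are nondecreasing and bounded by [#|I|], hence eventually
   constant. *)
have [||N _ Nmax] := @exists_argmax nat (fun=> True) (fun n => \dim (K n)) #|I|.
- by exists 0%N.
- move=> n _; rewrite (leq_trans (dimvS (subvf _)))// dimvf dim_free card_prod card_mx.
  by rewrite mul0n muln1.
exists (\dim (K N))%:R%:P, N => n leNn; rewrite hornerC; congr (_%:R); apply/eqP.
by rewrite eqn_leq Nmax// dim_submodule_mono.
Qed.

End SubmoduleDimensions.

(** * Finitely generated modules as quotients of free modules *)

Lemma has_dim_quotient (k : fieldType) (vT : vectType k) (M : lmodType k)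
    (ev : {linear vT -> M}) (U : {vspace vT}) :
  (forall y, exists x, y = ev x) -> (forall x, (x \in U) <-> ev x = 0) ->
  has_dim M (dim vT - \dim U).
Proof.
move=> evsurj Uker; rewrite -dimvf -dimv_compl; set C := (U^C)%VS.
(* A basis of a complement of the kernel maps to a basis of the quotient. *)
exists (fun i => ev (vbasis C)`_i); split=> [c|y].
  have -> : \sum_i c i *: ev (vbasis C)`_i = ev (\sum_i c i *: (vbasis C)`_i).
    by rewrite linear_sum; apply: eq_bigr => i _; rewrite linearZ.
  move/Uker => sU; have /freeP := basis_free (vbasisP C); apply.
  apply/eqP; rewrite -memv0 -(capv_compl U) memv_cap sU /= memv_suml// => i _.
  by rewrite memvZ// vbasis_mem// mem_nth// size_tuple.
have [x ->] := evsurj y; have : x \in (U + C)%VS by rewrite addv_complf memvf.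
case/memv_addP=> u /Uker u0 [v vC ->]; exists (fun i => coord (vbasis C) i v).
rewrite linearD u0 add0r {1}(coord_vbasis vC) linear_sum.
by apply: eq_bigr => i _; rewrite linearZ.
Qed.

Section Presentation.
Variables (F : finFieldType) (k : fieldType) (V : VImodule F k).
Variables (r : nat) (deg : 'I_r -> nat) (gen : forall i, V (deg i)).
Hypothesis genV : forall W : forall n, V n -> Prop, is_submodule W ->
  (forall i, W (deg i) (gen i)) -> forall n (x : V n), W n x.

Let d := \max_i deg i.
Let degd i : (deg i <= d)%N := leq_bigmax i.
Notation free B := {ffun B -> k^o}.

(** This brings all generators to the common degree [d]: generator [i] sees only the first [deg i]
    rows. *)
Definition top_rows i n (A : 'M[F]_(d, n)) : 'M_(deg i, n) := rowsub (widen_ord (degd i)) A.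

(** All matrices index the free module, so those with dependent top rows are sent to zero; injective
    maps preserve this distinction. *)
Definition basis_value n (a : Mt F 'I_r d n) : V n :=
  if row_free (top_rows a.1 a.2) then vi_act (top_rows a.1 a.2) (gen a.1) else 0.

Definition presentation n (x : free (Mt F 'I_r d n)) : V n :=
  \sum_a (x a : k) *: basis_value a.

Lemma presentation_linear n : linear (@presentation n).
Proof.
move=> c x y; rewrite /presentation scaler_sumr -big_split; apply: eq_bigr => a _ /=.
by rewrite !ffunE scalerDl scalerA.
Qed.

HB.instance Definition _ n :=
  GRing.isLinear.Build _ _ _ _ (@presentation n) (@presentation_linear n).

Lemma presentation_dlt n a : presentation (dlt k a) = basis_value a :> V n.
Proof.
rewrite /presentation (bigD1 a)//= ffunE eqxx scale1r big1 ?addr0// => b /negPf ba.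
by rewrite ffunE ba scale0r.
Qed.

Lemma vi_act0 n m (f : 'M[F]_(n, m)) : row_free f -> vi_act f (0 : V n) = 0.
Proof.
move=> ff; have := vi_act_lin ff 1 (0 : V n) 0.
by rewrite scaler0 addr0 scale1r => /eqP; rewrite -subr_eq subrr eq_sym => /eqP.
Qed.

Lemma vi_act_sum n m (f : 'M[F]_(n, m)) (J : Type) (s : seq J) (c : J -> k) (y : J -> V n) :
  row_free f -> vi_act f (\sum_(j <- s) c j *: y j) = \sum_(j <- s) c j *: vi_act f (y j).
Proof.
move=> ff; elim: s => [|j s IHs]; first by rewrite !big_nil vi_act0.
by rewrite !big_cons vi_act_lin// IHs.
Qed.

Lemma row_freeMr p n m (A : 'M[F]_(p, n)) (f : 'M[F]_(n, m)) :
  row_free f -> row_free (A *m f) = row_free A.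
Proof. by move=> ff; rewrite /row_free mxrankMfree. Qed.

Lemma basis_value_act n m (f : 'M[F]_(n, m)) a : row_free f ->
  basis_value (act f a) = vi_act f (basis_value a).
Proof.
move=> ff; rewrite /basis_value /= /top_rows -mul_rowsub_mx row_freeMr//.
by case: ifP => Afree; [rewrite vi_act_comp | rewrite vi_act0].
Qed.

Lemma presentation_act n m (f : 'M[F]_(n, m)) x : row_free f ->
  presentation (pusht k (act f) x) = vi_act f (presentation x).
Proof.
move=> ff; rewrite {2}/presentation vi_act_sum//.
rewrite {1}(ffun_sum_dlt x) !linear_sum /=; apply: eq_bigr => a _.
by rewrite !linearZ /= pusht_dlt presentation_dlt basis_value_act.
Qed.

Lemma presentation_surj n (y : V n) : exists x, y = presentation x.
Proof.
apply: (genV (W := fun n y => exists x, y = presentation x)) => [|i].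
  split=> [m|]; first by exists 0; rewrite linear0.
  split=> [m _ _ [x ->] [z ->]|]; first by exists (x + z); rewrite linearD.
  split=> [m c _ [x ->]|m p f _ ff [x ->]]; first by exists (c *: x); rewrite linearZ.
  by exists (pusht k (act f) x); rewrite presentation_act.
(* An identity block above zero rows, whose value is [gen i]. *)
pose A : 'M[F]_(d, deg i) := \matrix_(s, t) (s == t :> nat)%:R.
have A1 : top_rows i A = 1%:M by apply/matrixP=> s t; rewrite !mxE.
exists (dlt k (i, A)); rewrite presentation_dlt /basis_value /= A1.
by rewrite /row_free mxrank1 eqxx vi_act_id.
Qed.

Lemma exists_presentation_kernel : exists K : forall n, {vspace free (Mt F 'I_r d n)},
  VI_stable K /\ forall n x, (x \in K n) <-> presentation x = 0.
Proof.
have ex n : exists U : {vspace free (Mt F 'I_r d n)},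
    forall x, (x \in U) <-> presentation x = 0.
  apply: vspace_of_subspace => [|c x y x0 y0]; first exact: linear0.
  by rewrite linearP /= x0 y0 scaler0 addr0.
pose K n := sval (constructive_indefinite_description _ (ex n)).
have KE n x : (x \in K n) <-> presentation x = 0.
  by rewrite /K; case: constructive_indefinite_description.
exists K; split=> // n m f x ff /KE x0.
by apply/KE; rewrite presentation_act// x0 vi_act0.
Qed.

Lemma dim_presented : [pchar k] =i pred0 -> exists (P : {poly rat}) N,
  forall n, (N <= n)%N -> exists D, has_dim (V n) D /\ P.[(#|F| ^ n)%:R] = D%:R.
Proof.
move=> char0; have [K [Kst KE]] := exists_presentation_kernel.
have [P [N PN]] := dim_submodule char0 Kst.
(* The free module has dimension [r * q^(d * n)], the value of [r%:R *: 'X^d] at [q^n]; [P] accounts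
   for the kernel. *)
exists (r%:R *: 'X^d - P), N => n leNn.
exists (dim (free (Mt F 'I_r d n)) - \dim (K n))%N; split.
  by apply: (has_dim_quotient (ev := @presentation n)); [exact: presentation_surj | exact: KE].
rewrite natrB -?dimvf ?dimvS ?subvf// dimvf dim_free card_prod card_ord card_mx.
by rewrite hornerD hornerN PN// hornerZ hornerXn [(d * n)%N]mulnC expnM natrM !natrX.
Qed.

End Presentation.

Theorem theorem1p2 (F : finFieldType) (k : fieldType)
  (char0 : [pchar k] =i pred0) (V : VImodule F k) (fgV : VI_fin_gen V) :
  exists (P : {poly rat}) (N : nat),
    forall n : nat, (N <= n)%N ->
      exists d : nat, has_dim (V n) d /\ P.[((#|F| ^ n)%N)%:R] = d%:R.
Proof.
by have [r [deg [gen genV]]] := fgV; exact: dim_presented genV char0.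
Qed.
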